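(* Let $R$ be a $\ast$-ring. Then $R$ is $\ast$-reversible if and only if $R$ is $\ast$-symmetric.
   Context: All rings are associative with unity. A $\ast$-ring is a ring $R$ equipped with an involution $\ast$, i.e. a map $\ast:R\to R$ with $(x+y)^{\ast}=x^{\ast}+y^{\ast}$, $(xy)^{\ast}=y^{\ast}x^{\ast}$ and $(x^{\ast})^{\ast}=x$ for all $x,y\in R$. A $\ast$-ring $R$ is $\ast$-reversible if for all $a,b\in R$, $ab=0$ implies $b^{\ast}a=0$. A $\ast$-ring $R$ is $\ast$-symmetric if for all $a,b,c\in R$, $abc=0$ implies $acb^{\ast}=0$. *)

(* Defs.v *)
From mathcomp Require Import all_boot all_algebra.

Set Implicit Arguments.
Unset Strict Implicit.
Unset Printing Implicit Defensive.

Import GRing.Theory.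
Local Open Scope ring_scope.

(* A *-ring is a [pzRingType] (the zero ring is allowed) together with such a
   [star]; star 1 = 1 follows from the axioms. *)
Record ring_involution (R : pzRingType) (star : R -> R) : Prop := RingInvolution {
  starD : {morph star : x y / x + y >-> x + y};
  starM : {morph star : x y / x * y >-> y * x};
  starK : involutive star
}.

Definition star_reversible (R : pzRingType) (star : R -> R) : Prop :=
  forall a b : R, a * b = 0 -> star b * a = 0.

Definition star_symmetric (R : pzRingType) (star : R -> R) : Prop :=
  forall a b c : R, a * b * c = 0 -> a * c * star b = 0.

(* Main.v *)
Require Import Defs.
From mathcomp Require Import all_boot all_algebra.

(** In a *-reversible ring a vanishing product [x * y] also gives [x^* * y = 0]
    and [y * x = 0].  If [a * (b * c) = 0], then *-reversibility gives
    [c^* * (b^* * a) = 0]: the involution has reversed the order of [b] and [c].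
    Starring the left factor [c^*] restores [c], and exchanging the
    factors of [(c * b^* ) * a = 0] gives [a * c * b^* = 0].

    Conversely, *-symmetry for the triple [1, x, y] turns [x * y = 0] into
    [y * x^* = 0]; three uses of this rule lead from [a * b = 0] to
    [b^* * a = 0]. *)

Import GRing.Theory.
Local Open Scope ring_scope.

Lemma star0 {R : pzRingType} {star : R -> R} :
  ring_involution star -> star 0 = 0.
Proof.
by move=> h; apply: (@addrI _ (star 0)); rewrite -(starD h) !addr0.
Qed.

Lemma star_reversible_starl {R : pzRingType} {star : R -> R} {x y : R} :
  ring_involution star -> star_reversible star ->
  x * y = 0 -> star x * y = 0.
Proof.
move=> h rev /rev /(congr1 star).
by rewrite (starM h) (starK h) (star0 h).
Qed.

(** *-reversibility exchanges the factors at the price of starring [y];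
    starring that factor once more undoes this. *)
Lemma star_reversible_swap {R : pzRingType} {star : R -> R} {x y : R} :
  ring_involution star -> star_reversible star ->
  x * y = 0 -> y * x = 0.
Proof.
move=> h rev /rev /(star_reversible_starl h rev).
by rewrite (starK h).
Qed.

Lemma star_reversible_symmetric (R : pzRingType) (star : R -> R) :
  ring_involution star -> star_reversible star -> star_symmetric star.
Proof.
move=> h rev a b c; rewrite -mulrA => /rev.
rewrite (starM h) -mulrA => /(star_reversible_starl h rev).
rewrite (starK h) mulrA => /(star_reversible_swap h rev).
by rewrite mulrA.
Qed.

Lemma star_symmetric_reversible (R : pzRingType) (star : R -> R) :
  ring_involution star -> star_symmetric star -> star_reversible star.
Proof.
move=> h sym.
have sym1 x y : x * y = 0 -> y * star x = 0.
  by move=> xy0; have := sym 1 x y; rewrite !mul1r; apply.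
(* The successive products are b a^*, a^* b^* and b^* a^** = b^* a. *)
by move=> a b /sym1 /sym1 /sym1; rewrite (starK h).
Qed.

Theorem mainTheorem1 (R : pzRingType) (star : R -> R)
    (hstar : ring_involution star) :
  star_reversible star <-> star_symmetric star.
Proof.
split; first exact: star_reversible_symmetric.
exact: star_symmetric_reversible.
Qed.
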